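(* Let $A\in\mathbb{R}^{n\times n}$ be Metzler and let $E\in\mathbb{R}^{n\times q}$, $C\in\mathbb{R}^{q\times n}$, $F\in\mathbb{R}^{q\times q}$ be entrywise nonnegative (so that $(A,E,C,F)$ is internally positive). Let $q=q_1+\dots+q_N$ and $$\boldsymbol{\Delta}^{1}:=\{\Delta=\mathrm{diag}(\Delta_1,\ldots,\Delta_N):\ \Delta_i\in\mathbb{C}^{q_i\times q_i},\ \|\Delta_i\|_1\le 1\},\qquad \mathcal{D}_\Delta:=\{\mathrm{diag}(d_1I_{q_1},\ldots,d_NI_{q_N}):\ d_i>0\}.$$ Consider the uncertain system $\dot x=Ax+Ew$, $z=Cx+Fw$, $w=\Delta z$. The following statements are equivalent: (i) The uncertain system is asymptotically stable for all $\Delta\in\boldsymbol{\Delta}^{1}$. (ii) There exist a vector $\lambda\in\mathbb{R}^n_{>0}$ and a matrix $D\in\mathcal{D}_\Delta$ such that $$\begin{bmatrix}\lambda\\ D\mathbf{1}_q\end{bmatrix}^T\begin{bmatrix}A & E\\ C & F-I_q\end{bmatrix}<0 .$$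
   Context: A real matrix is Metzler if all its off-diagonal entries are nonnegative. $\|\cdot\|_1$ is the matrix norm induced by the vector 1-norm. $\mathbf{1}_q$ is the $q$-dimensional vector of ones. Vector inequalities are componentwise. The uncertain system is asymptotically stable for a given $\Delta$ if the interconnection is well posed ($I-F\Delta$ invertible) and the closed-loop matrix $A+E\Delta(I-F\Delta)^{-1}C$ is Hurwitz stable. *)

(* Defs.v *)
From HB Require Import structures.
From mathcomp Require Import all_boot all_order all_algebra.
From mathcomp Require Import complex.
From mathcomp Require Import reals.
Set Implicit Arguments. Unset Strict Implicit. Unset Printing Implicit Defensive.
Import Order.TTheory GRing.Theory Num.Theory.
Local Open Scope ring_scope.

Definition metzler (R : realType) (n : nat) (A : 'M[R]_n) : Prop :=
  forall i j : 'I_n, i != j -> 0 <= A i j.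

Definition nonneg_mx (R : realType) (m n : nat) (M : 'M[R]_(m, n)) : Prop :=
  forall i j, 0 <= M i j.

Definition cmx (R : realType) (m n : nat) (M : 'M[R]_(m, n)) : 'M[R[i]]_(m, n) :=
  map_mx (fun x => (x%:C)%C) M.

Definition vnorm1 (R : realType) (m : nat) (x : 'cV[R[i]]_m) : R :=
  \sum_(j < m) Normc.normc (x j 0).

(* ||M||_1 <= 1 for the matrix norm induced by the vector 1-norm,
   i.e. sup_{x<>0} ||M x||_1 / ||x||_1 <= 1, i.e. ||M x||_1 <= ||x||_1 for all x. *)
Definition induced_norm1_le1 (R : realType) (m : nat) (M : 'M[R[i]]_m) : Prop :=
  forall x : 'cV[R[i]]_m, vnorm1 (M *m x) <= vnorm1 x.

Definition hurwitz (R : realType) (n : nat) (M : 'M[R[i]]_n) : Prop :=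
  forall a : R[i], eigenvalue M a -> Re a < 0.

(* Asymptotic stability of the uncertain system for a given Delta:
   well-posedness (I - F Delta invertible) and A + E Delta (I - F Delta)^-1 C Hurwitz. *)
Definition unc_stable (R : realType) (n q : nat)
    (A : 'M[R]_n) (E : 'M[R]_(n, q)) (C : 'M[R]_(q, n)) (F : 'M[R]_q)
    (Delta : 'M[R[i]]_q) : Prop :=
  (1%:M - cmx F *m Delta) \in unitmx /\
  hurwitz (cmx A + cmx E *m Delta *m invmx (1%:M - cmx F *m Delta) *m cmx C).

(* Main.v *)
(* The condition on [lambda] and [D] says that the weighted 1-norm
   [lambda^T |x| + sum_i d_i |w_i|_1] certifies stability: if [x] is an eigenvector of
   the closed loop for an eigenvalue in the closed right half-plane, and [w] is the
   matching uncertainty output, then [A |x| + E |w| >= 0] because [A] is Metzler, and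
   [|w_i|_1 <= |(C |x| + F |w|)_i|_1] on each block, contradicting the strict
   inequality.  Conversely, if no such weights exist, Gordan's alternative yields
   nonnegative [(x, w) <> 0] with [A x + E w >= 0] and
   [1^T w_i <= 1^T (C x + F w)_i] on each block.  The rank-one blocks sending
   [(C x + F w)_i] to [w_i] form an admissible nonnegative uncertainty whose closed
   loop [M] is Metzler with [M x >= 0], hence has a real eigenvalue [>= 0]. *)
Require Import Defs.
From HB Require Import structures.
From mathcomp Require Import all_boot all_order all_algebra.
From mathcomp Require Import complex polyrcf.
From mathcomp Require Import reals.
Set Implicit Arguments. Unset Strict Implicit. Unset Printing Implicit Defensive.
Import Order.TTheory GRing.Theory Num.Theory.
Local Open Scope ring_scope.

(** * Signs and largest roots of real polynomials *)

Lemma monic_gt0_of_noroot (R : rcfType) (p : {poly R}) (s : R) :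
  p \is monic -> (forall t : R, s <= t -> ~~ root p t) -> 0 < p.[s].
Proof.
move=> /monicP lcp nroot.
have [|y py] := @poly_pinfty_gt_lc _ p; first by rewrite lcp ltr01.
rewrite ltNge; apply/negP => ps_le0.
have le_sb : s <= Num.max y s by rewrite le_max lexx orbT.
have pb_gt0 : 0 < p.[Num.max y s].
  by rewrite (lt_le_trans _ (py _ _)) ?lcp ?ltr01 // le_max lexx.
have [|t /andP[le_st _] rt] := poly_ivt le_sb (p := p).
  by rewrite ps_le0 ltW.
by have /negP := nroot t le_st; apply.
Qed.

(** By continuity, a negative value at [t] would persist at some [t + d / 2]. This carries a sign
    known to the right of a root over to the root itself. *)
Lemma horner_ge0_at_right (R : rcfType) (p : {poly R}) (t : R) :
  (forall s, t < s -> 0 <= p.[s]) -> 0 <= p.[t].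
Proof.
move=> p_ge0; rewrite leNgt; apply/negP => pt_lt0.
have [|d d_gt0 near_t] := @poly_cont _ t p (- p.[t]); first by rewrite oppr_gt0.
have d2_gt0 : 0 < d / 2 by rewrite divr_gt0.
have := near_t (t + d / 2); rewrite addrAC subrr add0r gtr0_norm //.
rewrite ltr_pdivrMr // ltr_pMr // ltr1n => /(_ isT) /(le_lt_trans (ler_norm _)).
by rewrite ltrBlDr addNr ltNge p_ge0 // ltrDl.
Qed.

Lemma max_root (R : rcfType) (p : {poly R}) (r t : R) :
  p != 0 -> r <= t -> root p t ->
  exists u, [/\ r <= u, root p u & forall s, u < s -> ~~ root p s].
Proof.
(* No root lies at or beyond [b], by the Cauchy bound. The root search runs over an open interval,
   so its ends [r - 1] and [b] are chosen strictly on either side of [t]. *)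
move=> p_neq0 le_rt pt0; set b := Num.max (cauchy_bound p) (t + 1).
have lt_tb : t < b by rewrite lt_max ltrDl ltr01 orbT.
have lt_at : r - 1 < t by rewrite (lt_le_trans _ le_rt) // gtrBl ltr01.
case: (prev_rootP p (r - 1) b) => [p0|u _ /eqP pu0 u_in noroot_u|c _ _ noroot_c].
- by move: p_neq0; rewrite p0 eqxx.
- exists u; split=> //.
    rewrite (le_trans le_rt) // leNgt; apply/negP => lt_ut.
    by move: (noroot_u t); rewrite in_itv /= lt_ut lt_tb pt0 => /(_ isT).
  move=> s lt_us; case: (ltP s b) => [lt_sb|le_bs].
    by apply: noroot_u; rewrite in_itv /= lt_us.
  apply: (ge_cauchy_bound p_neq0); rewrite in_itv /= andbT.
  by rewrite (le_trans _ le_bs) // le_max lexx.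
- by move: (noroot_c t); rewrite in_itv /= lt_at lt_tb pt0 => /(_ isT).
Qed.

(** * Resolvents of Metzler matrices *)

Lemma horner_char_poly (R : comNzRingType) n (B : 'M[R]_n) (s : R) :
  (char_poly B).[s] = \det (s%:M - B).
Proof.
rewrite -horner_evalE -det_map_mx; congr (\det _).
by apply/matrixP => i j; rewrite !mxE /= /horner_eval !hornerE hornerMn hornerX.
Qed.

Lemma det_block_schur (F : fieldType) n1 n2 (Aul : 'M[F]_n1) (Aur : 'M_(n1, n2))
    (Adl : 'M_(n2, n1)) (Adr : 'M_n2) :
  Adr \in unitmx ->
  \det (block_mx Aul Aur Adl Adr) =
    \det (Aul - Aur *m invmx Adr *m Adl) * \det Adr.
Proof.
move=> uA.
have -> : block_mx Aul Aur Adl Adr = block_mx 1%:M (Aur *m invmx Adr) 0 1%:M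
    *m block_mx (Aul - Aur *m invmx Adr *m Adl) 0 Adl Adr.
  by rewrite mulmx_block !mul1mx !mul0mx !add0r subrK mulmxKV.
by rewrite det_mulmx det_ublock det_lblock !det1 !mul1r.
Qed.

Lemma nonneg_mulmx (R : realType) m n p (M : 'M[R]_(m, n)) (P : 'M_(n, p)) :
  nonneg_mx M -> nonneg_mx P -> nonneg_mx (M *m P).
Proof. by move=> M0 P0 i j; rewrite mxE sumr_ge0 // => k _; rewrite mulr_ge0. Qed.

(* Induction on the dimension.  Let [B'] be [B] without its first row and column.
   At the largest root [u >= r] of [char_poly B'], the Schur complement formula and
   the induction hypothesis to the right of [u] give [(char_poly B).[u] <= 0], which
   is impossible; so [B'] satisfies the hypotheses as well, and eliminating the last
   block of coordinates leaves a positive scalar times the first one. *)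
Lemma metzler_resolvent_mono (R : realType) n (B : 'M[R]_n) (r : R) (x : 'cV_n) :
  metzler B -> (forall s, r <= s -> ~~ root (char_poly B) s) ->
  nonneg_mx ((r%:M - B) *m x) -> nonneg_mx x.
Proof.
elim: n => [|n IHn] in B r x *; first by move=> _ _ _ [].
rewrite -[n.+1]/(1 + n)%N in B x *.
set B' := drsubmx B; set c := ursubmx B; set e := dlsubmx B => mB nrB.
have mB' : metzler B'.
  by move=> i j ij; rewrite !mxE mB // (inj_eq (@rshift_inj _ _)).
have c0 : nonneg_mx c by move=> i j; rewrite !mxE mB // eq_lrshift.
have e0 : nonneg_mx e by move=> i j; rewrite !mxE mB // eq_rlshift.
have blockB s : s%:M - B = block_mx (s%:M - ulsubmx B) (- c) (- e) (s%:M - B').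
  by rewrite -{1}[B]submxK scalar_mx_block opp_block_mx add_block_mx !add0r.
have unitB' (t : R) : (forall s, t <= s -> ~~ root (char_poly B') s) ->
    (t%:M - B') \in unitmx.
  move=> /(_ _ (lexx _)); rewrite /root horner_char_poly => d0.
  by rewrite unitmxE unitfE.
have inv_e (t : R) : (forall s, t <= s -> ~~ root (char_poly B') s) ->
    nonneg_mx (invmx (t%:M - B') *m e).
  move=> nrB'; apply: (IHn B' t) => //.
  by rewrite mulmxA mulmxV ?unitB' // mul1mx.
have detB (t : R) : (forall s, t <= s -> ~~ root (char_poly B') s) ->
    (char_poly B).[t] =
      (t - B 0 0 - (c *m (invmx (t%:M - B') *m e)) 0 0) * (char_poly B').[t].
  move=> nrB'; rewrite !horner_char_poly blockB det_block_schur ?unitB' //.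
  rewrite det_mx11 mulNmx mulmxN mulNmx opprK -mulmxA; congr (_ * _).
  by rewrite !mxE lshift0 eqxx.
have nrB' s : r <= s -> ~~ root (char_poly B') s.
  move=> le_rs; apply/negP => rs.
  have [u [le_ru ru nru]] := max_root (monic_neq0 (char_poly_monic B')) le_rs rs.
  (* Right of [u], [detB] turns this difference into [c (v - B')^-1 e] times [(char_poly B').[v]], a
     product of nonnegative factors. At [u] the first product vanishes, leaving [- (char_poly
     B).[u]]. *)
  have : 0 <= (('X - (B 0 0)%:P) * char_poly B' - char_poly B).[u].
    apply: horner_ge0_at_right => v lt_uv.
    have nrv t : v <= t -> ~~ root (char_poly B') t.
      by move=> le_vt; rewrite nru // (lt_le_trans lt_uv).
    rewrite hornerD hornerN hornerM hornerXsubC (detB v nrv) -mulrBl opprB addrC.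
    rewrite addrNK mulr_ge0 ?nonneg_mulmx //; first exact: inv_e.
    exact: ltW (monic_gt0_of_noroot (char_poly_monic _) nrv).
  rewrite hornerD hornerN hornerM (rootP ru) mulr0 sub0r oppr_ge0 leNgt.
  rewrite monic_gt0_of_noroot ?char_poly_monic // => t le_ut.
  by rewrite nrB // (le_trans le_ru).
(* This Schur complement is the quotient of the two characteristic polynomials at [r], both of which
   are positive there. *)
have sigma_gt0 : 0 < r - B 0 0 - (c *m (invmx (r%:M - B') *m e)) 0 0.
  have := monic_gt0_of_noroot (char_poly_monic B) nrB.
  by rewrite detB // pmulr_lgt0 // (monic_gt0_of_noroot (char_poly_monic B') nrB').
have uB' := unitB' r nrB'; have inv_e_r := inv_e r nrB'.
rewrite blockB -{1}[x]vsubmxK mul_block_col => x0.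
set x1 := usubmx x in x0; set x2 := dsubmx x in x0.
set f := invmx (r%:M - B') *m e in sigma_gt0 inv_e_r.
have x1E : x1 = (x1 0 0)%:M by apply/matrixP => i j; rewrite !ord1 !mxE eqxx.
(* [r - B'] maps this vector to the lower block of [(r - B) x]. *)
have x2f : nonneg_mx (x2 - x1 0 0 *: f).
  apply: (IHn B' r) => // i j.
  rewrite mulmxBr -scalemxAr mulmxA mulmxV // mul1mx.
  have := x0 (rshift 1 i) j; rewrite col_mxEd {1}x1E mul_mx_scalar scalerN.
  by rewrite addrC.
(* Adding [c (x2 - x1 f)] to the first row of [(r - B) x] cancels [x2] and leaves the Schur
   complement times [x1]. *)
have x1_ge0 : 0 <= x1 0 0.
  rewrite -(pmulr_rge0 _ sigma_gt0).
  have := addr_ge0 (x0 (lshift n 0) 0) (nonneg_mulmx c0 x2f 0 0).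
  rewrite col_mxEu mulmxBr -scalemxAr {1}x1E mul_mx_scalar mulNmx.
  rewrite !mxE lshift0 eqxx mulr1n addrCA.
  set y := \sum_j _; set z := \sum_j _.
  by rewrite addrA [y + _]addrC subrK mulrBl mulrC [x 0 0 * z]mulrC.
move=> i j; rewrite !ord1 -[x]vsubmxK; case: (split_ordP i) => k ->.
  by rewrite col_mxEu ord1.
rewrite col_mxEd -/x2 -[x2](subrK (x1 0 0 *: f)) [X in 0 <= X]mxE.
by rewrite addr_ge0 // mxE mulr_ge0.
Qed.

Lemma metzler_resolvent_mono_mx (R : realType) n p (B : 'M[R]_n) (r : R)
    (X : 'M_(n, p)) :
  metzler B -> (forall s, r <= s -> ~~ root (char_poly B) s) ->
  nonneg_mx ((r%:M - B) *m X) -> nonneg_mx X.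
Proof.
move=> mB nrB X0 i j.
suff /(_ i 0) : nonneg_mx (col j X) by rewrite mxE.
apply: (metzler_resolvent_mono mB nrB) => k l.
by rewrite colE mulmxA -colE mxE.
Qed.

(** * Gordan's theorem of the alternative *)

Lemma strict_separation (R : realFieldType) (L U : seq R) :
  {in L & U, forall l u, l < u} ->
  exists t, {in L, forall l, l < t} /\ {in U, forall u, t < u}.
Proof.
have maxP (x : R) s : exists2 m, m \in x :: s & {in x :: s, forall y, y <= m}.
  elim: s x => [|y s IHs] x; first by exists x => [|z]; rewrite !inE // => /eqP->.
  have [m m_in m_ub] := IHs y; have [le_xm|/ltW le_mx] := leP x m.
    by exists m => [|z]; rewrite inE ?m_in ?orbT // => /predU1P[->|/m_ub].
  exists x => [|z]; rewrite inE ?eqxx // => /predU1P[->|/m_ub] //.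
  by move=> /le_trans; apply.
have minP (x : R) s : exists2 m, m \in x :: s & {in x :: s, forall y, m <= y}.
  have [m m_in m_ub] := maxP (- x) (map -%R s).
  exists (- m) => [|y y_in]; first by rewrite -(mem_map oppr_inj) /= opprK.
  by rewrite lerNl m_ub // -map_cons (mem_map oppr_inj).
case: L U => [|l L] [|u U] ltLU.
- by exists 0; split.
- have [m _ m_lb] := minP u U; exists (m - 1); split=> // v /m_lb.
  by apply: lt_le_trans; rewrite gtrBl ltr01.
- have [m _ m_ub] := maxP l L; exists (m + 1); split=> // v /m_ub.
  by move=> /le_lt_trans; apply; rewrite ltrDl ltr01.
have [a a_in a_ub] := maxP l L; have [b b_in b_lb] := minP u U.
have [lt_at lt_tb] := midf_lt (ltLU a b a_in b_in).
exists ((a + b) / 2); split=> v.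
  by move=> /a_ub /le_lt_trans; apply.
by move=> /b_lb; apply: lt_le_trans.
Qed.

(* Fourier-Motzkin elimination.  Quantifying over every [Q] closed under the
   cone operations encodes membership of [0] in the semi-positive cone of [s]. *)
Lemma gordan_seq (R : realFieldType) m (s : seq 'cV[R]_m) :
  (exists y : 'rV_m, {in s, forall v, 0 < (y *m v) 0 0}) \/
  (forall Q : 'cV[R]_m -> Prop, {in s, forall v, Q v} ->
     (forall u v, Q u -> Q v -> Q (u + v)) ->
     (forall a v, 0 < a -> Q v -> Q (a *: v)) -> Q 0).
Proof.
elim: m s => [|m IHm] s.
  case: s => [|v s]; [by left; exists 0 | right=> Q Qs _ _].
  by rewrite -(flatmx0 v); apply: Qs; rewrite mem_head.
rewrite -[m.+1]/(1 + m)%N in s *.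
pose hd (v : 'cV[R]_(1 + m)) := v 0 0.
(* For [hd p > 0 > hd n] both coefficients are positive, and the heads cancel. *)
pose elim_hd p n : 'cV[R]_(1 + m) := (- hd n) *: p + hd p *: n.
pose pos := [seq v <- s | 0 < hd v]; pose neg := [seq v <- s | hd v < 0].
pose s' := [seq v <- s | hd v == 0] ++ [seq elim_hd p n | p <- pos, n <- neg].
have hdE (v : 'cV[R]_(1 + m)) : v = col_mx (hd v)%:M (dsubmx v).
  rewrite -{1}[v]vsubmxK; congr col_mx; apply/matrixP => i j.
  by rewrite !ord1 !mxE lshift0 eqxx.
have hd0 v : v \in s' -> hd v = 0.
  rewrite mem_cat mem_filter => /orP[/andP[/eqP]//|/allpairsP[[p n] [_ _ ->]]].
  by rewrite /hd /elim_hd !mxE mulNr mulrC addNr.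
have [[y ys]|Qs] := IHm (map dsubmx s'); last first.
  right=> Q Qs' QD QZ.
  (* All vectors of [s'] have zero head, so the cone they generate lies in the slice of vectors
     [col_mx 0 u]. *)
  have := Qs (fun u => Q (col_mx 0 u)); rewrite col_mx0; apply.
  - move=> _ /mapP[v vs ->]; rewrite -[0](raddf0 (@scalar_mx R 1)) -(hd0 v vs) -hdE.
    move: vs; rewrite mem_cat mem_filter => /orP[/andP[_ /Qs']//|].
    case/allpairsP=> [[p n] []]; rewrite !mem_filter => /andP[p0 ps] /andP[n0 ns] ->.
    by apply: QD; apply: QZ; rewrite ?oppr_gt0 //; apply: Qs'.
  - by move=> u v Qu Qv; rewrite -[0]addr0 -add_col_mx; apply: QD.
  - by move=> a v a0 Qv; rewrite -(scaler0 _ a) -scale_col_mx; apply: QZ.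
left; pose z (v : 'cV[R]_(1 + m)) := (y *m dsubmx v) 0 0.
have zs v : v \in s' -> 0 < z v by move=> vs; apply/ys/map_f.
(* The missing coordinate [t] must satisfy [t * hd v + z v > 0] for every [v]. This is a lower bound
   on [t] when [hd v > 0] and an upper bound when [hd v < 0]; the bounds are compatible because [z]
   is positive on each [elim_hd p n]. *)
have [|t [Lt tU]] :=
  @strict_separation R [seq - z p / hd p | p <- pos] [seq z n / - hd n | n <- neg].
  move=> _ _ /mapP[p ps ->] /mapP[n ns ->].
  have: elim_hd p n \in s'.
    by rewrite mem_cat; apply/orP; right; apply: allpairs_f.
  move: ps ns; rewrite !mem_filter => /andP[p0 _] /andP[n0 _] /zs.
  have -> : z (elim_hd p n) = - hd n * z p + hd p * z n.
    by rewrite /z /elim_hd linearD !linearZ /= mulmxDr -!scalemxAr !mxE.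
  rewrite mulNr => zpn; rewrite ltr_pdivrMr // mulrAC ltr_pdivlMr ?oppr_gt0 //.
  by rewrite mulNr mulrN opprK mulrC -subr_gt0 addrC [z n * _]mulrC.
exists (row_mx t%:M y) => v vs.
rewrite {1}(hdE v) mul_row_col -scalar_mxM mxE -/(z v) mxE eqxx mulr1n.
case: (ltgtP (hd v) 0) => hv.
- have := tU (z v / - hd v); rewrite ltr_pdivlMr ?oppr_gt0 // mulrN -subr_gt0.
  rewrite opprK addrC; apply; apply/mapP; exists v => //.
  by rewrite mem_filter hv.
- have := Lt (- z v / hd v); rewrite ltr_pdivrMr // -subr_gt0 opprK.
  by apply; apply/mapP; exists v => //; rewrite mem_filter hv.
- by rewrite hv mulr0 add0r zs // mem_cat mem_filter hv eqxx vs.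
Qed.

(** The images under [G] of nonzero nonnegative vectors contain the columns of [G] and are closed
    under the cone operations, since nonnegative entries cannot cancel. Taking this set for [Q] in
    [gordan_seq] makes [Q 0] the second alternative. *)
Lemma gordan (R : realFieldType) m k (G : 'M[R]_(m, k)) :
  (exists y : 'rV_m, forall j, 0 < (y *m G) 0 j) \/
  (exists x : 'cV_k, [/\ forall j, 0 <= x j 0, x != 0 & G *m x = 0]).
Proof.
have [[y ys]|] := gordan_seq [seq col j G | j : 'I_k].
  left; exists y => j; have /ys : col j G \in [seq col j G | j : 'I_k] by apply: image_f.
  by rewrite colE mulmxA -colE mxE.
move=> /(_ (fun u => exists x : 'cV_k,
  [/\ forall j, 0 <= x j 0, x != 0 & G *m x = u])) ex; right; apply: ex.
- move=> _ /imageP[j _ ->]; exists (delta_mx j 0); rewrite -colE; split=> //.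
    by move=> i; rewrite mxE ler0n.
  by apply/eqP => /matrixP/(_ j 0)/eqP; rewrite !mxE !eqxx oner_eq0.
- move=> _ _ [x [x0 xn0 <-]] [y [y0 _ <-]]; exists (x + y); split.
  + by move=> j; rewrite mxE addr_ge0.
  + apply: contraNneq xn0 => xy0; apply/eqP/matrixP => i j; rewrite ord1 mxE.
    apply/eqP; move/matrixP/(_ i 0)/eqP: xy0; rewrite !mxE paddr_eq0 //.
    by case/andP.
  + exact: mulmxDr.
- move=> a _ a0 [x [x0 xn0 <-]]; exists (a *: x); split.
  + by move=> j; rewrite mxE mulr_ge0 // ltW.
  + by rewrite scaler_eq0 negb_or gt_eqF.
  + by rewrite scalemxAr.
Qed.

(** * Entrywise moduli and sums over blocks *)

Definition abs_mx (R : realType) m n (M : 'M[R[i]]_(m, n)) : 'M[R]_(m, n) :=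
  map_mx (@Normc.normc R) M.

Lemma normc_ge0 (R : realType) (x : R[i]) : 0 <= Normc.normc x.
Proof. by case: x => a b; exact: sqrtr_ge0. Qed.

Lemma Re_le_normc (R : realType) (x : R[i]) : complex.Re x <= Normc.normc x.
Proof.
case: x => a b /=; apply: le_trans (ler_norm _) _.
by rewrite -sqrtr_sqr ler_wsqrtr // lerDl sqr_ge0.
Qed.

Lemma normc_real (R : realType) (x : R) : 0 <= x -> Normc.normc x%:C%C = x.
Proof. by move=> x0; rewrite /= expr0n /= addr0 sqrtr_sqr ger0_norm. Qed.

Lemma le_normc_sum (R : realType) (I : finType) (P : pred I) (f : I -> R[i]) :
  Normc.normc (\sum_(k | P k) f k) <= \sum_(k | P k) Normc.normc (f k).
Proof.
elim/big_ind2: _ => [|x a y b xa yb|//]; first by rewrite Normc.normc0.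
by apply: le_trans (lerD xa yb); exact: le_normcD.
Qed.

Lemma abs_mx_ge0 (R : realType) m n (M : 'M[R[i]]_(m, n)) : nonneg_mx (abs_mx M).
Proof. by move=> i j; rewrite mxE normc_ge0. Qed.

Lemma abs_mx_eq0 (R : realType) m n (M : 'M[R[i]]_(m, n)) : abs_mx M = 0 -> M = 0.
Proof.
move=> M0; apply/matrixP => i j; move/matrixP/(_ i j): M0; rewrite !mxE.
exact: Normc.eq0_normc.
Qed.

Lemma abs_cmx_mul_le (R : realType) m n p (M : 'M[R]_(m, n))
    (x : 'M[R[i]]_(n, p)) k l :
  nonneg_mx M -> Normc.normc ((cmx M *m x) k l) <= (M *m abs_mx x) k l.
Proof.
move=> M0; rewrite !mxE; apply: le_trans (le_normc_sum _ _) _.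
by apply: ler_sum => i _; rewrite !mxE Normc.normcM normc_real.
Qed.

Lemma vnorm1E (R : realType) m (x : 'cV[R[i]]_m) :
  vnorm1 x = \sum_j abs_mx x j 0.
Proof. by apply: eq_bigr => j _; rewrite mxE. Qed.

Lemma sum_tagnat (V : nmodType) N (qs : 'I_N -> nat)
    (f : 'I_(\sum_(i < N) qs i) -> V) :
  \sum_k f k = \sum_i \sum_(a < qs i) f (tagnat.Rank i a).
Proof.
rewrite (reindex _ (tagnat.rank_bij_on (p_ := qs))) /=.
by rewrite sig_big_dep; apply: eq_bigr => -[].
Qed.

(** * From the weights to robust stability *)

Lemma mxdiag_scalar_col (R : pzRingType) N (qs : 'I_N -> nat) (d : 'I_N -> R) k :
  ((mxdiag (fun i => (d i)%:M) : 'M_(\sum_(i < N) qs i)) *m const_mx 1 :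
     'cV_(\sum_(i < N) qs i)) k 0 = d (tagnat.sig1 k).
Proof.
rewrite -[const_mx 1]submxcolK mul_mxdiag_mxcol mxE mul_scalar_mx !mxE.
exact: mulr1.
Qed.

(** The weight is constant on each block, so the sum splits into [d i] times the 1-norm of block
    [i], and each block of the uncertainty is a contraction. *)
Lemma weighted_abs_mxdiag_le (R : realType) N (qs : 'I_N -> nat) (d : 'I_N -> R)
    (Ds : forall i : 'I_N, 'M[R[i]]_(qs i)) (z : 'cV_(\sum_(i < N) qs i)) :
  (forall i, 0 < d i) -> (forall i, induced_norm1_le1 (Ds i)) ->
  \sum_k d (tagnat.sig1 k) * abs_mx (mxdiag Ds *m z) k 0 <=
  \sum_k d (tagnat.sig1 k) * abs_mx z k 0.
Proof.
move=> d0 nDs.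
have weightedE (u : 'cV[R[i]]_(\sum_(i < N) qs i)) :
  \sum_k d (tagnat.sig1 k) * abs_mx u k 0 = \sum_i d i * vnorm1 (submxcol u i).
  rewrite sum_tagnat; apply: eq_bigr => i _; rewrite mulr_sumr.
  by apply: eq_bigr => a _; rewrite tagnat.Rank1K !mxE.
rewrite !weightedE; apply: ler_sum => i _; rewrite (ler_wpM2l (ltW (d0 i))) //.
rewrite -{1}[z]submxcolK mul_mxdiag_mxcol mxcolK; exact: nDs.
Qed.

(** Row [k] reads [(a - A k k) x_k = sum_(j != k) A k j x_j + u_k]. Take moduli: the off-diagonal
    entries are nonnegative, and [|a - A k k| >= Re a - A k k >= - A k k]. *)
Lemma metzler_eigen_abs (R : realType) n (A : 'M[R]_n) (x u : 'cV[R[i]]_n)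
    (g : 'cV[R]_n) (a : R[i]) :
  metzler A -> (forall k, abs_mx u k 0 <= g k 0) -> 0 <= complex.Re a ->
  cmx A *m x + u = a *: x -> nonneg_mx (A *m abs_mx x + g).
Proof.
move=> mA ug a0 /matrixP eqx k j; rewrite ord1 {j}.
have := eqx k 0; rewrite !mxE (bigD1 k) //= !mxE -addrA.
move=> eqxk.
have normx : Normc.normc (a - (A k k)%:C%C) * Normc.normc (x k 0) <=
    \sum_(j | j != k) A k j * Normc.normc (x j 0) + g k 0.
  rewrite -Normc.normcM mulrBl -eqxk [X in Normc.normc X]addrC addKr; apply: le_trans (le_normcD _ _) _.
  apply: lerD; last by have := ug k; rewrite mxE.
  apply: le_trans (le_normc_sum _ _) _; apply: ler_sum => j jk.
  by rewrite mxE Normc.normcM normc_real // mA // eq_sym.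
rewrite (bigD1 k) //= !mxE -addrA.
have -> : \sum_(j | j != k) A k j * abs_mx x j 0 =
    \sum_(j | j != k) A k j * Normc.normc (x j 0).
  by apply: eq_bigr => j _; rewrite mxE.
apply: le_trans (lerD (lexx _) normx); rewrite -mulrDl mulr_ge0 ?normc_ge0 //.
rewrite -lerBlDl sub0r; apply: le_trans (Re_le_normc _).
by rewrite raddfB /= lerBrDl subrr.
Qed.

Lemma inj_unitmx (F : fieldType) n (M : 'M[F]_n) :
  (forall x : 'cV_n, M *m x = 0 -> x = 0) -> M \in unitmx.
Proof.
move=> Minj; rewrite -unitmx_tr unitmxE unitfE; apply/det0P => -[v vn0 vM].
move/negP: vn0; apply; rewrite -[v]trmxK (Minj v^T) ?trmx0 //.
by apply: trmx_inj; rewrite trmx_mul trmxK vM trmx0.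
Qed.

Lemma neg_form_nonneg_eq0 (R : realType) p (r : 'rV[R]_p) (c : 'cV[R]_p) :
  (forall j, r 0 j < 0) -> nonneg_mx c -> 0 <= (r *m c) 0 0 -> c = 0.
Proof.
move=> r_lt0 c0; rewrite mxE -oppr_le0 -sumrN => rc.
have term0 j : 0 <= - (r 0 j * c j 0) by rewrite -mulNr mulr_ge0 // oppr_ge0 ltW.
have : \sum_j - (r 0 j * c j 0) == 0 by rewrite eq_le rc sumr_ge0.
rewrite psumr_eq0 => [/allP z|//]; apply/matrixP => j l; rewrite ord1 mxE.
by apply/eqP; have := z j (mem_index_enum _); rewrite oppr_eq0 mulf_eq0 lt_eqF.
Qed.

(** The negative row is paired with [(|x|, |w|)]. The [lam] part is nonnegative by assumption, and
    the [D] part because the uncertainty contracts the [D]-weighted 1-norm, so both moduli vanish.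
    It serves twice: with [x = 0] for well-posedness, and with an eigenvector for stability. *)
Lemma interconnection_trivial (R : realType) (n N : nat) (qs : 'I_N -> nat)
    (A : 'M[R]_n) (E : 'M[R]_(n, \sum_(i < N) qs i))
    (C : 'M[R]_(\sum_(i < N) qs i, n)) (F : 'M[R]_(\sum_(i < N) qs i))
    (lam : 'cV[R]_n) (d : 'I_N -> R) (Ds : forall i : 'I_N, 'M[R[i]]_(qs i))
    (x : 'cV[R[i]]_n) (w : 'cV[R[i]]_(\sum_(i < N) qs i)) :
  nonneg_mx E -> nonneg_mx C -> nonneg_mx F ->
  (forall k, 0 < lam k 0) -> (forall i, 0 < d i) ->
  (let D : 'M[R]_(\sum_(i < N) qs i) := mxdiag (fun i => (d i)%:M) in
   let v := col_mx lam (D *m const_mx 1) in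
   forall j, ((v^T *m block_mx A E C (F - 1%:M)) 0 j < 0)) ->
  (forall i, induced_norm1_le1 (Ds i)) ->
  nonneg_mx (A *m abs_mx x + E *m abs_mx w) ->
  w = mxdiag Ds *m (cmx C *m x + cmx F *m w) -> x = 0 /\ w = 0.
Proof.
move=> E0 C0 F0 lam0 d0 /= lmi nDs Ax0 eqw.
set dv := _ *m const_mx 1 in lmi.
have dvE k : dv k 0 = d (tagnat.sig1 k) by exact: mxdiag_scalar_col.
have dw : 0 <= (dv^T *m (C *m abs_mx x + F *m abs_mx w - abs_mx w)) 0 0.
  rewrite mulmxBr mxE [X in _ + X]mxE subr_ge0.
  have dvM u : (dv^T *m u) 0 0 = \sum_k d (tagnat.sig1 k) * u k 0.
    by rewrite mxE; apply: eq_bigr => k _; rewrite mxE dvE.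
  rewrite !dvM {1}eqw; apply: le_trans (weighted_abs_mxdiag_le _ d0 nDs) _.
  apply: ler_sum => k _; rewrite (ler_wpM2l (ltW (d0 _))) // [leLHS]mxE [leRHS]mxE mxE.
  apply: le_trans (le_normcD _ _) _.
  by apply: lerD; apply: abs_cmx_mul_le.
have: col_mx (abs_mx x) (abs_mx w) = 0.
  apply: neg_form_nonneg_eq0 lmi _ _.
    by move=> i j; rewrite mxE; case: splitP => k _; apply: abs_mx_ge0.
  rewrite -mulmxA mul_block_col tr_col_mx mul_row_col mxE addr_ge0 //.
    by apply: nonneg_mulmx => // i j; rewrite mxE ord1 ltW.
  by rewrite mulmxBl mul1mx addrA.
by rewrite -col_mx0 => /eq_col_mx[/abs_mx_eq0-> /abs_mx_eq0->].
Qed.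

Lemma unc_stable_of_lmi (R : realType) (n N : nat) (qs : 'I_N -> nat)
    (A : 'M[R]_n) (E : 'M[R]_(n, \sum_(i < N) qs i))
    (C : 'M[R]_(\sum_(i < N) qs i, n)) (F : 'M[R]_(\sum_(i < N) qs i))
    (lam : 'cV[R]_n) (d : 'I_N -> R) (Ds : forall i : 'I_N, 'M[R[i]]_(qs i)) :
  metzler A -> nonneg_mx E -> nonneg_mx C -> nonneg_mx F ->
  (forall k, 0 < lam k 0) -> (forall i, 0 < d i) ->
  (let D : 'M[R]_(\sum_(i < N) qs i) := mxdiag (fun i => (d i)%:M) in
   let v := col_mx lam (D *m const_mx 1) in
   forall j, ((v^T *m block_mx A E C (F - 1%:M)) 0 j < 0)) ->
  (forall i, induced_norm1_le1 (Ds i)) -> unc_stable A E C F (mxdiag Ds).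
Proof.
move=> mA E0 C0 F0 lam0 d0 lmi nDs.
have triv x w := @interconnection_trivial R n N qs A E C F lam d Ds x w
  E0 C0 F0 lam0 d0 lmi nDs.
set Delta := mxdiag Ds in triv *.
have uW : 1%:M - cmx F *m Delta \in unitmx.
  apply: inj_unitmx => z /eqP; rewrite mulmxBl mul1mx subr_eq0 => /eqP zE.
  (* A kernel vector [z] of [1 - F Delta] is a signal of the interconnection with zero state and
     [w = Delta z]. *)
  have [||_ w0] := triv 0 (Delta *m z).
  - rewrite [abs_mx 0](_ : _ = 0) ?mulmx0 ?add0r.
      by apply: nonneg_mulmx => //; apply: abs_mx_ge0.
    by apply/matrixP => i j; rewrite !mxE Normc.normc0.
  - by rewrite mulmx0 add0r (mulmxA (cmx F)) -zE.
  by rewrite zE -mulmxA w0 mulmx0.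
split=> // a eig; rewrite -complexRe ltcR ltNge; apply/negP => a0.
move: eig; set M := _ + _; rewrite eigenvalue_root_char /root horner_char_poly.
suff: a%:M - M \in unitmx by rewrite unitmxE unitfE => /negP.
apply: inj_unitmx => x; rewrite mulmxBl mul_scalar_mx => /eqP.
rewrite subr_eq0 => /eqP/esym Mx.
(* An eigenvector [x] determines the signal [z = C x + F w] with [w = Delta z], to which [triv]
   applies. *)
set z := invmx (1%:M - cmx F *m Delta) *m (cmx C *m x).
have zE : z = cmx C *m x + cmx F *m (Delta *m z).
  apply/eqP; rewrite -subr_eq mulmxA -{1}[z]mul1mx -mulmxBl /z mulmxA.
  by rewrite mulmxV // mul1mx.
have [||//] := triv x (Delta *m z); last by rewrite -zE.
apply: (metzler_eigen_abs mA _ a0 (u := cmx E *m (Delta *m z))) => [k|].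
  by rewrite mxE; apply: abs_cmx_mul_le.
by rewrite -Mx mulmxDl !mulmxA.
Qed.

(** * The worst-case nonnegative uncertainty *)

Lemma mxdiag_ind (V : nmodType) (P : V -> Prop) N (qs : 'I_N -> nat)
    (D : forall i : 'I_N, 'M[V]_(qs i)) :
  P 0 -> (forall i a b, P (D i a b)) -> forall k l, P (mxdiag D k l).
Proof.
move=> P0 PD k l; rewrite mxE; move: (tagnat.sig2 k) (tagnat.sig2 l).
move: (tagnat.sig1 k) (tagnat.sig1 l) => i j a b.
case: eqVneq => [e|_]; last by rewrite mxE.
by move: b; rewrite -{j}e => b; rewrite conform_mx_id.
Qed.

Lemma map_mxdiag (V W : nmodType) (f : V -> W) N (qs : 'I_N -> nat)
    (D : forall i : 'I_N, 'M[V]_(qs i)) :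
  f 0 = 0 -> map_mx f (mxdiag D) = mxdiag (fun i => map_mx f (D i)).
Proof.
move=> f0; apply/matrixP => k l; rewrite !mxE.
case: eqP => _; last by rewrite !mxE.
by have /matrixP/(_ (tagnat.sig2 k) (tagnat.sig2 l)) :=
  map_conform_mx f (D (tagnat.sig1 k))
    (0 : 'M_(qs (tagnat.sig1 k), qs (tagnat.sig1 l)));
  rewrite mxE => ->; congr (conform_mx _ _ _ _); apply/matrixP => i j; rewrite !mxE.
Qed.

(** The induced 1-norm of a nonnegative matrix is its largest column sum; the bound comes from
    exchanging the two sums. *)
Lemma induced_norm1_le1_cmx (R : realType) m (D : 'M[R]_m) :
  nonneg_mx D -> (forall b, \sum_a D a b <= 1) -> induced_norm1_le1 (cmx D).
Proof.
move=> D0 colD x; apply: (@le_trans _ _ (\sum_a (D *m abs_mx x) a 0)).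
  by apply: ler_sum => a _; apply: abs_cmx_mul_le.
under eq_bigr do rewrite mxE; rewrite exchange_big vnorm1E /=.
apply: ler_sum => b _; rewrite -mulr_suml -[leRHS]mul1r.
by rewrite ler_wpM2r // abs_mx_ge0.
Qed.

(** As a matrix, the map from [u] to its block sums can enter the system given to Gordan's
    alternative; multiplied on the left by a row [d], it gives the transpose of [D 1_q]. *)
Definition block_sum (R : realType) N (qs : 'I_N -> nat) :
    'M[R]_(N, \sum_(i < N) qs i) :=
  \matrix_(i, k) (tagnat.sig1 k == i)%:R.

Lemma block_sumE (R : realType) N (qs : 'I_N -> nat)
    (u : 'cV[R]_(\sum_(i < N) qs i)) i :
  (block_sum R qs *m u) i 0 = \sum_(a < qs i) u (tagnat.Rank i a) 0.
Proof.
rewrite mxE sum_tagnat (bigD1 i) //= [X in _ + X]big1 ?addr0 => [|j ji].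
  by apply: eq_bigr => a _; rewrite mxE tagnat.Rank1K eqxx mul1r.
by apply: big1 => a _; rewrite mxE tagnat.Rank1K (negPf ji) mul0r.
Qed.

(* The worst-case uncertainty: each block [w_i 1^T / (1^T z_i)] has rank one and
   maps [z_i] to [w_i].  Blocks with [1^T z_i = 0] are zero because [x / 0 = 0]. *)
Definition worst_block (R : realType) N (qs : 'I_N -> nat)
    (z w : 'cV[R]_(\sum_(i < N) qs i)) (i : 'I_N) : 'M[R]_(qs i) :=
  \matrix_(a, b) (w (tagnat.Rank i a) 0 / (block_sum R qs *m z) i 0).

Lemma block_sum_ge0 (R : realType) N (qs : 'I_N -> nat)
    (u : 'cV[R]_(\sum_(i < N) qs i)) i :
  nonneg_mx u -> 0 <= (block_sum R qs *m u) i 0.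
Proof. by move=> u0; rewrite block_sumE sumr_ge0. Qed.

Lemma worst_block_ge0 (R : realType) (N : nat) (qs : 'I_N -> nat)
    (z w : 'cV[R]_(\sum_(i < N) qs i)) i :
  nonneg_mx z -> nonneg_mx w -> nonneg_mx (worst_block z w i).
Proof. by move=> z0 w0 a b; rewrite mxE divr_ge0 // block_sum_ge0. Qed.

(** Every column of the block sums to [t] times the ratio of the block sums of [w] and [z], which is
    at most 1. The factor [t] keeps the whole segment from 0 to the worst case admissible. *)
Lemma worst_block_norm (R : realType) (N : nat) (qs : 'I_N -> nat)
    (z w : 'cV[R]_(\sum_(i < N) qs i)) (t : R) i :
  nonneg_mx z -> nonneg_mx w ->
  (block_sum R qs *m w) i 0 <= (block_sum R qs *m z) i 0 -> 0 <= t <= 1 ->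
  induced_norm1_le1 (cmx (t *: worst_block z w i)).
Proof.
move=> z0 w0 le_wz /andP[t0 t1]; apply: induced_norm1_le1_cmx => [a b|b].
  by rewrite mxE mulr_ge0 // worst_block_ge0.
under eq_bigr do rewrite mxE mxE; rewrite -mulr_sumr -mulr_suml -block_sumE.
rewrite mulr_ile1 ?divr_ge0 ?block_sum_ge0 //.
have [->|zi] := eqVneq ((block_sum R qs *m z) i 0) 0; first by rewrite invr0 mulr0.
by rewrite ler_pdivrMr ?mul1r // lt_def zi block_sum_ge0.
Qed.

Lemma worst_mxdiagE (R : realType) (N : nat) (qs : 'I_N -> nat)
    (z w : 'cV[R]_(\sum_(i < N) qs i)) :
  nonneg_mx w ->
  (forall i, (block_sum R qs *m w) i 0 <= (block_sum R qs *m z) i 0) ->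
  mxdiag (worst_block z w) *m z = w.
Proof.
move=> w0 le_wz.
rewrite -{2}[z]submxcolK mul_mxdiag_mxcol; apply/matrixP => k l.
rewrite ord1 mxE mxE; set i := tagnat.sig1 k.
transitivity (w k 0 / (block_sum R qs *m z) i 0 * (block_sum R qs *m z) i 0).
  rewrite [X in _ = _ * X]block_sumE mulr_sumr; apply: eq_bigr => b _.
  by rewrite !mxE tagnat.sig2K.
have [zi|zi] := eqVneq ((block_sum R qs *m z) i 0) 0; last by rewrite divfK.
(* If block [i] of [z] sums to 0, then so does the nonnegative block [i] of [w], which therefore
   vanishes, in agreement with the zero block. *)
rewrite zi mulr0; apply/esym/eqP.
have := le_wz i; rewrite zi block_sumE => sw0.
have : \sum_(a < qs i) w (tagnat.Rank i a) 0 == 0 by rewrite eq_le sw0 sumr_ge0.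
rewrite psumr_eq0 // => /allP/(_ (tagnat.sig2 k) (mem_index_enum _)).
by rewrite tagnat.sig2K.
Qed.

(** * The closed loop under the worst-case uncertainty *)

Lemma metzler_add_nonneg (R : realType) n (A P : 'M[R]_n) :
  metzler A -> nonneg_mx P -> metzler (A + P).
Proof. by move=> mA P0 i j ij; rewrite mxE addr_ge0 // mA. Qed.

Lemma cmxM (R : realType) m n p (M : 'M[R]_(m, n)) (P : 'M_(n, p)) :
  cmx (M *m P) = cmx M *m cmx P.
Proof. exact: (map_mxM (real_complex R)). Qed.

Lemma cmxD (R : realType) m n (M P : 'M[R]_(m, n)) : cmx (M + P) = cmx M + cmx P.
Proof. exact: (map_mxD (real_complex R)). Qed.

Lemma cmx_unitmx (R : realType) n (M : 'M[R]_n) :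
  (cmx M \in unitmx) = (M \in unitmx).
Proof. exact: (map_unitmx (real_complex R)). Qed.

Lemma cmx_invmx (R : realType) n (M : 'M[R]_n) : cmx (invmx M) = invmx (cmx M).
Proof. exact: (map_invmx (real_complex R)). Qed.

Lemma cmx_well_posed (R : realType) q (F D : 'M[R]_q) :
  1%:M - cmx F *m cmx D = cmx (1%:M - F *m D).
Proof.
by rewrite -cmxM /cmx (map_mxB (real_complex R)) (map_mx1 (real_complex R)).
Qed.

(** The worst-case uncertainty built from [z] and [w] realises these signals in a closed loop [M]
    that is Metzler with [M x >= 0]. Stability makes [- M] inverse-nonnegative, hence [- x >= 0]. *)
Lemma stable_nonneg_trivial (R : realType) (n N : nat) (qs : 'I_N -> nat)
    (A : 'M[R]_n) (E : 'M[R]_(n, \sum_(i < N) qs i))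
    (C : 'M[R]_(\sum_(i < N) qs i, n)) (F : 'M[R]_(\sum_(i < N) qs i))
    (x : 'cV[R]_n) (w : 'cV[R]_(\sum_(i < N) qs i)) :
  metzler A -> nonneg_mx E -> nonneg_mx C -> nonneg_mx F ->
  (forall Ds : forall i : 'I_N, 'M[R[i]]_(qs i),
      (forall i, induced_norm1_le1 (Ds i)) ->
      unc_stable A E C F (mxdiag Ds)) ->
  nonneg_mx x -> nonneg_mx w -> nonneg_mx (A *m x + E *m w) ->
  nonneg_mx (block_sum R qs *m (C *m x + F *m w - w)) -> x = 0 /\ w = 0.
Proof.
move=> mA E0 C0 F0 stab x0 w0 Ax0 Sz0; set z := C *m x + F *m w in Sz0.
have z0 : nonneg_mx z by move=> i j; rewrite mxE addr_ge0 // nonneg_mulmx.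
have le_wz i : (block_sum R qs *m w) i 0 <= (block_sum R qs *m z) i 0.
  by rewrite -subr_ge0; have := Sz0 i 0; rewrite mulmxBr !mxE.
pose Delta := mxdiag (worst_block z w).
have Delta0 : nonneg_mx Delta.
  move=> k l; apply: (mxdiag_ind (P := fun v => 0 <= v)) => // i a b.
  exact: worst_block_ge0.
have Deltaz : Delta *m z = w by apply: worst_mxdiagE.
have stabt t : 0 <= t <= 1 -> unc_stable A E C F (cmx (t *: Delta)).
  move=> t01; have := stab _ (fun i => worst_block_norm z0 w0 (le_wz i) t01).
  have scaleE : t *: Delta = map_mx ( *%R t) Delta.
    by apply/matrixP => k l; rewrite !mxE.
  rewrite scaleE (map_mxdiag (worst_block z w) (mulr0 t)).
  rewrite /cmx (map_mxdiag _ (f := fun u => u%:C%C) (erefl : 0%:C%C = 0)).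
  congr (unc_stable A E C F _); apply: eq_mxdiag => i.
  by apply/matrixP => k l; rewrite !mxE.
have mB : metzler (F *m Delta - 1%:M).
  rewrite addrC; apply: metzler_add_nonneg; last exact: nonneg_mulmx.
  by move=> i j ij; rewrite !mxE (negPf ij) oppr0.
(* Since [s - (F Delta - 1) = (1 + s) (1 - F (Delta / (1 + s)))], well-posedness for the scaled
   uncertainty [Delta / (1 + s)] excludes the root [s]. *)
have nrB s : 0 <= s -> ~~ root (char_poly (F *m Delta - 1%:M)) s.
  move=> s0; have s1 : 0 < 1 + s by rewrite ltr_pwDl.
  have [|+ _] := stabt (1 + s)^-1.
    by rewrite invr_ge0 ltW // invf_le1 // lerDl.
  rewrite cmx_well_posed cmx_unitmx unitmxE unitfE.
  rewrite /root horner_char_poly; apply: contraNN => /eqP d0.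
  have -> : 1%:M - F *m ((1 + s)^-1 *: Delta) =
      (1 + s)^-1 *: (s%:M - (F *m Delta - 1%:M)).
    rewrite opprB addrA -raddfD /= [s + 1]addrC scalerBr scale_scalar_mx.
    by rewrite mulVf ?gt_eqF // scalemxAr.
  by rewrite detZ d0 mulr0.
have WE : 0%:M - (F *m Delta - 1%:M) = 1%:M - F *m Delta.
  by rewrite raddf0 sub0r opprB.
have [|+ hurw] := stabt 1; first by rewrite ler01 lexx.
move: hurw; rewrite scale1r cmx_well_posed cmx_unitmx => hurw uW.
set W := 1%:M - F *m Delta in hurw uW WE.
pose K := invmx W *m C.
(* Resolvent monotonicity at 0 for the Metzler matrix [F Delta - 1] shows that [1 - F Delta] has a
   nonnegative inverse. *)
have K0 : nonneg_mx K.
  by apply: metzler_resolvent_mono_mx mB nrB _; rewrite WE mulmxA mulmxV // mul1mx.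
have Kx : K *m x = z.
  have Wz : W *m z = C *m x.
    by rewrite mulmxBl mul1mx -mulmxA Deltaz /z addrK.
  by rewrite /K -mulmxA -Wz mulmxA mulVmx // mul1mx.
pose M := A + E *m Delta *m K.
have clE : cmx A + cmx E *m cmx Delta *m invmx (cmx W) *m cmx C = cmx M.
  by rewrite /M cmxD !cmxM cmx_invmx !mulmxA.
rewrite clE in hurw.
have mM : metzler M.
  by apply: metzler_add_nonneg => //; apply: nonneg_mulmx => //; apply: nonneg_mulmx.
have nrM s : 0 <= s -> ~~ root (char_poly M) s.
  move=> s0; apply/negP; rewrite -eigenvalue_root_char.
  rewrite -(eigenvalue_map (real_complex R)) => /hurw.
  by rewrite -complexRe ltcR ltNge s0.
(* Here [M x = A x + E Delta z = A x + E w >= 0], so monotonicity of the resolvent of [M] at 0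
   applies to [- x]. *)
have xN : nonneg_mx (- x).
  apply: (metzler_resolvent_mono mM nrM).
  rewrite raddf0 sub0r mulmxN mulNmx opprK mulmxDl -[_ *m K *m x]mulmxA Kx.
  by rewrite -mulmxA Deltaz.
have xE : x = 0.
  apply/matrixP => i j; apply/eqP; rewrite mxE eq_le x0 andbT.
  by have := xN i j; rewrite mxE oppr_ge0.
by rewrite -Deltaz -Kx xE !mulmx0.
Qed.

Theorem theorem1 (R : realType) (n N : nat) (qs : 'I_N -> nat)
    (A : 'M[R]_n) (E : 'M[R]_(n, \sum_(i < N) qs i))
    (C : 'M[R]_(\sum_(i < N) qs i, n)) (F : 'M[R]_(\sum_(i < N) qs i)) :
  metzler A -> nonneg_mx E -> nonneg_mx C -> nonneg_mx F ->
  (forall Ds : forall i : 'I_N, 'M[R[i]]_(qs i),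
      (forall i, induced_norm1_le1 (Ds i)) ->
      unc_stable A E C F (mxdiag Ds))
  <->
  (exists (lam : 'cV[R]_n) (d : 'I_N -> R),
      (forall k, 0 < lam k 0) /\ (forall i, 0 < d i) /\
      let D : 'M[R]_(\sum_(i < N) qs i) := mxdiag (fun i => (d i)%:M) in
      let v := col_mx lam (D *m const_mx 1) in
      forall j, ((v^T *m block_mx A E C (F - 1%:M)) 0 j < 0)).
Proof.
move=> mA E0 C0 F0; split=> [stab|[lam [d [lam0 [d0 lmi]]]] Ds]; last first.
  exact: unc_stable_of_lmi mA E0 C0 F0 lam0 d0 lmi.
set S := block_sum R qs.
pose G0 := block_mx A E (S *m C) (S *m (F - 1%:M)).
(* The block [- G0] encodes the strict inequality, and the identity block makes the weights in [y]
   positive. In the other alternative [c] consists of [(x, w)] and a slack [s >= 0] with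
   [G0 (x, w) = s]. *)
have [[y yG]|[c [c0 cn0 Gc]]] := gordan (row_mx (- G0) 1%:M).
  have y0 i : 0 < y 0 i by have := yG (rshift _ i); rewrite mul_mx_row row_mxEr mulmx1.
  exists (lsubmx y)^T, (fun i => y 0 (rshift n i)); split; last split=> //.
    by move=> k; rewrite !mxE.
  move=> /= j; rewrite tr_col_mx trmxK.
  have -> : (mxdiag (fun i => (y 0 (rshift n i))%:M) *m const_mx 1 :
      'cV_(\sum_(i < N) qs i))^T = rsubmx y *m S.
    apply/matrixP => i k; rewrite ord1 mxE mxdiag_scalar_col mxE.
    rewrite (bigD1 (tagnat.sig1 k)) //= [X in _ + X]big1 ?addr0 => [|l lk].
      by rewrite !mxE eqxx mulr1.
    by rewrite !mxE eq_sym (negPf lk) mulr0.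
  have := yG (lshift _ j); rewrite mul_mx_row row_mxEl mulmxN mxE oppr_gt0.
  by rewrite -{1}[y]hsubmxK !mul_row_block !mulmxA.
have [xw0 s0] : nonneg_mx (usubmx c) /\ nonneg_mx (dsubmx c).
  by split=> i j; rewrite mxE ord1.
move: Gc; rewrite -[c in _ *m c]vsubmxK mul_row_col mul1mx mulNmx addrC.
move=> /eqP; rewrite subr_eq0 => /eqP Gc.
move: s0; rewrite Gc -{1}[usubmx c]vsubmxK mul_block_col -!mulmxA -mulmxDr => s0.
have [||||xE wE] := @stable_nonneg_trivial R n N qs A E C F
  (usubmx (usubmx c)) (dsubmx (usubmx c)) mA E0 C0 F0 stab.
- by move=> i j; rewrite mxE.
- by move=> i j; rewrite mxE.
- by move=> i j; have := s0 (lshift _ i) j; rewrite col_mxEu.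
- move=> i j; have := s0 (rshift _ i) j; rewrite col_mxEd.
  by rewrite mulmxBl mul1mx addrA.
(* Once [(x, w)] vanishes, so does the slack [G0 (x, w)], contradicting [c != 0]. *)
have xw : usubmx c = 0 by rewrite -[usubmx c]vsubmxK xE wE col_mx0.
by move: cn0; rewrite -[c]vsubmxK Gc xw mulmx0 col_mx0 eqxx.
Qed.
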